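(* Let $(\Omega,\mathcal A,\mu)$ be a $\sigma$-finite measure space, let $u\in L^1(\Omega)$ and $K\in(0,\mu(\Omega))$. Then the following statements are equivalent: (1) $\|u\|_0\le K$; (2) $\|u\|_1=|u|_K$; (3) $|u|_H=|u|_K$ for all $H\in(K,\mu(\Omega)]$. In addition, these statements imply (4) $|u|_h=|u|_K$ for one (i.e., there exists) $h\in(K,\mu(\Omega)]$.
   Context: For measurable $u:\Omega\to\mathbb R$, $\|u\|_0:=\mu(\{x\in\Omega\mid u(x)\ne0\})$. For $u\in L^1(\Omega)$ and $K\in[0,\mu(\Omega)]$ the largest-$K$-norm is $|u|_K:=\sup_{A\in\mathcal A:\ \mu(A)\le K}\int_A|u|\,d\mu$. $\|u\|_1$ is the $L^1(\Omega)$-norm. *)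

(* Defs.v *)
From HB Require Import structures.
From mathcomp Require Import all_boot all_order all_algebra.
From mathcomp Require Import all_classical all_reals all_analysis.

Set Implicit Arguments.
Unset Strict Implicit.
Unset Printing Implicit Defensive.

Import Order.TTheory GRing.Theory Num.Theory.
Import numFieldNormedType.Exports.

Local Open Scope classical_set_scope.
Local Open Scope ring_scope.
Local Open Scope ereal_scope.

Definition l0norm d (T : measurableType d) (R : realType)
    (mu : {measure set T -> \bar R}) (u : T -> R) : \bar R :=
  mu [set x | u x != 0%R].

(* The bound K is an extended real because it may equal mu(Omega), which is
   +oo when mu is not finite. *)
Definition largest_norm d (T : measurableType d) (R : realType)
    (mu : {measure set T -> \bar R}) (K : \bar R) (u : T -> R) : \bar R :=
  ereal_sup [set \int[mu]_(x in A) `|u x|%:E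
            | A in [set A : set T | measurable A /\ mu A <= K]].

(* Main.v *)
Require Import Defs.
From mathcomp Require Import all_boot all_order all_algebra.
From mathcomp Require Import all_classical all_reals all_analysis.
From mathcomp Require Import measurable_realfun.
Import Order.TTheory GRing.Theory Num.Theory.

Set Implicit Arguments.
Unset Strict Implicit.
Unset Printing Implicit Defensive.

Local Open Scope classical_set_scope.
Local Open Scope ring_scope.
Local Open Scope ereal_scope.

(** Enlarging the constraint set increases the largest-K-norm, which never
    exceeds the L1 norm and equals it when K bounds the measure of the support.
    Conversely, a set A with mu A <= K misses at least mu M - K of each
    superlevel set M = {|u| >= t}, so the integral over A falls short of the
    L1 norm by at least t (mu M - K).  Equality of the norms therefore forces
    mu {|u| >= t} <= K for every t > 0, and t -> 0 gives the bound on the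
    support. *)

Lemma measurable_abs_superlevel (R : realType) (d : measure_display)
    (T : measurableType d) (u : T -> R) (mfu : measurable_fun setT u) (t : R) :
  measurable [set x | (t <= `|u x|)%R].
Proof.
rewrite -[X in measurable X]setTI; apply: measurable_fun_le => //.
exact: measurableT_comp.
Qed.

Lemma measurable_abs_EFin (R : realType) (d : measure_display)
    (T : measurableType d) (u : T -> R) (mfu : measurable_fun setT u)
    (D : set T) :
  measurable_fun D (fun x => `|u x|%:E).
Proof.
by apply: measurable_funTS; apply/measurable_EFinP; exact: measurableT_comp.
Qed.

(** By the Archimedean property, every nonzero [|u x|] exceeds some [n.+1^-1]. A countable
    increasing union yields both measurability of the support and access to continuity of [mu] from
    below. *)
Lemma support_bigcup_superlevel (R : realType) (T : Type) (u : T -> R) :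
  [set x | u x != 0%R] = \bigcup_n [set x | (n.+1%:R^-1 <= `|u x|)%R].
Proof.
apply/seteqP; split=> x /=.
- rewrite -normr_gt0 => /ltr_add_invr[k]; rewrite add0r => kx.
  by exists k => //=; exact: ltW.
- by move=> [n _ /=] nx; rewrite -normr_gt0; apply: lt_le_trans nx.
Qed.

Lemma largest_norm_mono (R : realType) (d : measure_display)
    (T : measurableType d) (mu : {measure set T -> \bar R}) (u : T -> R)
    (K H : \bar R) : K <= H -> largest_norm mu K u <= largest_norm mu H u.
Proof.
move=> KH; apply: le_ereal_sup => _ [A [mA AK] <-].
by exists A => //; split=> //; exact: le_trans KH.
Qed.

Lemma largest_norm_ge (R : realType) (d : measure_display)
    (T : measurableType d) (mu : {measure set T -> \bar R}) (u : T -> R)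
    (K : \bar R) (A : set T) : measurable A -> mu A <= K ->
  \int[mu]_(x in A) `|u x|%:E <= largest_norm mu K u.
Proof. by move=> mA AK; apply: ereal_sup_ubound; exists A. Qed.

Lemma largest_norm_le_L1 (R : realType) (d : measure_display)
    (T : measurableType d) (mu : {measure set T -> \bar R}) (u : T -> R)
    (mfu : measurable_fun setT u) (K : \bar R) :
  largest_norm mu K u <= \int[mu]_x `|u x|%:E.
Proof.
apply: ge_ereal_sup => _ [A [mA _] <-].
apply: ge0_subset_integral => //.
exact: measurable_abs_EFin.
Qed.

Lemma largest_norm_setT (R : realType) (d : measure_display)
    (T : measurableType d) (mu : {measure set T -> \bar R}) (u : T -> R)
    (mfu : measurable_fun setT u) :
  largest_norm mu (mu setT) u = \int[mu]_x `|u x|%:E.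
Proof.
by apply/eqP; rewrite eq_le largest_norm_le_L1//= largest_norm_ge.
Qed.

Lemma largest_norm_l0norm_le (R : realType) (d : measure_display)
    (T : measurableType d) (mu : {measure set T -> \bar R}) (u : T -> R)
    (mfu : measurable_fun setT u) (K : \bar R) :
  l0norm mu u <= K -> largest_norm mu K u = \int[mu]_x `|u x|%:E.
Proof.
move=> uK; apply/eqP; rewrite eq_le largest_norm_le_L1//=.
have mS : measurable [set x | u x != 0%R].
  rewrite support_bigcup_superlevel; apply: bigcupT_measurable => n.
  exact: measurable_abs_superlevel.
apply: le_trans (largest_norm_ge u mS uK).
(* The support is itself an admissible set, and extending [|u|] by zero outside it gives back
   [|u|]. *)
rewrite [leRHS]integral_mkcond le_eqVlt; apply/orP; left; apply/eqP.
apply: eq_integral => x _; rewrite patchE; case: ifPn => //.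
by rewrite notin_setE /= => /negP; rewrite negbK => /eqP ->; rewrite normr0.
Qed.

(** The integral over the complement of [A] is at least [t] times the measure of the part of the
    superlevel set outside [A]. Stating this with sums on both sides avoids subtracting possibly
    infinite measures. *)
Lemma integral_superlevel_gap (R : realType) (d : measure_display)
    (T : measurableType d) (mu : {measure set T -> \bar R}) (u : T -> R)
    (mfu : measurable_fun setT u) (t : R) (A : set T) :
  (0 <= t)%R -> measurable A ->
  \int[mu]_(x in A) `|u x|%:E + t%:E * mu [set x | (t <= `|u x|)%R]
    <= \int[mu]_x `|u x|%:E + t%:E * mu A.
Proof.
move=> t0 mA; set M := [set x | _].
have mM : measurable M by exact: measurable_abs_superlevel.
have mMA : measurable (M `\` A) by exact: measurableD.
have -> : \int[mu]_x `|u x|%:E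
    = \int[mu]_(x in A) `|u x|%:E + \int[mu]_(x in ~` A) `|u x|%:E.
  rewrite -ge0_integral_setU ?setUv//; first exact: measurableC.
  - exact: measurable_abs_EFin.
  - by apply/disj_set2P; rewrite setICr.
rewrite -addeA; apply: leeD2l.
have MA : mu M <= mu (M `\` A) + mu A.
  apply: le_trans (measureU2 mu mMA mA).
  apply: le_measure; rewrite ?inE//; first exact: measurableU.
  by move=> x Mx; have [|nAx] := pselect (A x); [right|left].
apply: le_trans (lee_wpmul2l _ MA) _; first by rewrite lee_fin.
rewrite ge0_muleDr//; apply: leeD2r.
(* Read [t * mu (M \ A)] as the integral of the constant [t], which lies below [|u|] on [M]. *)
rewrite -integral_cst//.
apply: (@le_trans _ _ (\int[mu]_(x in M `\` A) `|u x|%:E)).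
  apply: ge0_le_integral => //=; first exact: measurable_abs_EFin.
  by move=> x [Mx _]; rewrite lee_fin.
apply: ge0_subset_integral => //; first exact: measurableC.
  exact: measurable_abs_EFin.
Qed.

Lemma superlevel_le_largest_norm (R : realType) (d : measure_display)
    (T : measurableType d) (mu : {measure set T -> \bar R}) (u : T -> R)
    (iu : mu.-integrable setT (EFin \o u)) (K : \bar R) (t : R) :
  0 <= K -> (0 < t)%R -> largest_norm mu K u = \int[mu]_x `|u x|%:E ->
  mu [set x | (t <= `|u x|)%R] <= K.
Proof.
move=> K0 t0 uK.
have [+ ifin] := integrableP _ _ _ iu.
move=> /measurable_EFinP mfu.
have Ifin : \int[mu]_x `|u x|%:E \is a fin_num.
  by rewrite ge0_fin_numE//; apply: integral_ge0.
case: K K0 uK => [k|_ _|//]; last by rewrite leey.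
rewrite lee_fin => k0 uK.
set M := [set x | _].
have Mfin : mu M \is a fin_num.
  rewrite ge0_fin_numE//.
  (* For [A] empty the gap estimate is Markov's inequality, so integrability makes [mu M] finite. *)
  have := integral_superlevel_gap mu mfu (ltW t0) (@measurable0 _ T).
  rewrite integral_set0 add0e measure0 mule0 adde0 -/M => h.
  by rewrite -(@lte_pmul2l _ t%:E)// gt0_muley ?(le_lt_trans h).
have tMfin : t%:E * mu M \is a fin_num by rewrite fin_numM.
rewrite -(@lee_pmul2l _ t%:E)//.
(* Finiteness of the L1 norm and of [t * mu M] permits isolating the L1 norm on the left. By [uK] it
   is a supremum, so bounding the integral over each admissible [A] suffices, with no maximizer
   required. *)
rewrite -(@leeD2lE _ (\int[mu]_x `|u x|%:E))// -leeBrDr// -[leLHS]uK.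
apply: ge_ereal_sup => _ [A [mA AK] <-]; rewrite leeBrDr//.
apply: le_trans (integral_superlevel_gap mu mfu (ltW t0) mA) _.
by apply: leeD2l; apply: lee_wpmul2l => //; rewrite lee_fin ltW.
Qed.

Lemma l0norm_le_largest_norm (R : realType) (d : measure_display)
    (T : measurableType d) (mu : {measure set T -> \bar R}) (u : T -> R)
    (iu : mu.-integrable setT (EFin \o u)) (K : \bar R) :
  0 <= K -> largest_norm mu K u = \int[mu]_x `|u x|%:E -> l0norm mu u <= K.
Proof.
move=> K0 uK.
have [/measurable_EFinP mfu _] := integrableP _ _ _ iu.
rewrite /l0norm support_bigcup_superlevel.
pose F n := [set x | (n.+1%:R^-1 <= `|u x|)%R].
have mF n : measurable (F n) by exact: measurable_abs_superlevel.
have ndF : nondecreasing_seq F.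
  move=> m n mn; apply/subsetPset => x /=; apply: le_trans.
  by rewrite lef_pV2 ?posrE// ler_nat.
(* Continuity from below: the measure of the support is the limit of the [mu (F n)], each at most
   [K]. *)
have cvF := nondecreasing_cvg_mu (mu := mu) mF (bigcupT_measurable F mF) ndF.
rewrite -(cvg_lim _ cvF)//; apply: lime_le; first by apply: cvgP; exact: cvF.
by apply: nearW => n; exact: superlevel_le_largest_norm.
Qed.

Theorem theorem3p22 (R : realType) (d : measure_display)
    (T : measurableType d) (mu : {sigma_finite_measure set T -> \bar R})
    (u : T -> R) (hu : u \in Lfun mu 1)
    (K : \bar R) (hK0 : 0 < K) (hK : K < mu [set: T]) :
  let S1 := l0norm mu u <= K in
  let S2 := 'N[mu]_1[EFin \o u] = largest_norm mu K u in
  let S3 := forall H : \bar R, K < H -> H <= mu [set: T] ->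
              largest_norm mu H u = largest_norm mu K u in
  let S4 := exists h : \bar R, [/\ K < h, h <= mu [set: T] &
              largest_norm mu h u = largest_norm mu K u] in
  (S1 <-> S2) /\ (S2 <-> S3) /\ (S1 -> S4).
Proof.
move=> S1 S2 S3 S4.
have /Lfun1_integrable iu := hu.
have [/measurable_EFinP mfu _] := integrableP _ _ _ iu.
have NE : 'N[mu]_1[EFin \o u] = \int[mu]_x `|u x|%:E by rewrite Lnorm1.
have S12 : S1 -> S2 by rewrite /S2 NE => /(largest_norm_l0norm_le mfu) ->.
have S23 : S2 -> S3.
  rewrite /S2 NE => E H KH _; apply/eqP.
  (* The norm at [H] is squeezed between the norm at [K] and the L1 norm, which agree by [E]. *)
  rewrite eq_le -[X in _ <= X]E largest_norm_le_L1//=.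
  by rewrite largest_norm_mono// ltW.
split; first split=> //.
  by rewrite /S2 NE => E; apply: (l0norm_le_largest_norm iu) => //; exact: ltW.
split; first split=> //.
  (* The endpoint [H = mu setT] is allowed since [K < mu setT], and there the norm is the L1 norm.
     The same endpoint is the witness for [S4]. *)
  by move=> /(_ _ hK (lexx _)); rewrite /S2 NE largest_norm_setT.
by move=> /S12/S23 E; exists (mu setT); split=> //; exact: E.
Qed.
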